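(* Let $(P,B)$ be a $(K,K',F,F',Z,Z',S)$-HpPDA and let $N\ge 1$. Then there exists a $(K,K',N)$ hotplug coded caching scheme with the following parameters: (i) the subpacketization level is $F'$ (each file is divided into $F'$ equal-size subfiles); (ii) $\frac{M}{N}=\frac{Z}{F'}$, where $M$ is the number of files each user can store in its cache, and $M<N$; (iii) the rate is $R=\frac{S}{F'}$. Moreover, such a scheme is obtained by the HpPDA-based algorithm described in the context, in which an $[F,F']$ MDS code is used for encoding the subfiles of each file.
   Context: Notation: $[n]=\{1,\dots,n\}$. Hotplug coded caching. In a $(K,K',N)$ hotplug coded caching system ($K'\le K$) a server stores $N$ files $W_1,\dots,W_N$, each of size $L$ bits (for a suitable $L$, so that files can be split and MDS-coded as needed), and is connected to $K$ users by an error-free shared link; each user has a cache of size $M$ files ($ML$ bits). In the placement phase the server fills the caches with functions of the files, knowing $K'$ but neither the identity of the $K'$ users who will be active nor the demands. In the delivery phase an arbitrary set $I\subseteq[K]$, $|I|=K'$, of active users reveals arbitrary demands $(d_i)_{i\in I}\in[N]^{I}$; the server broadcasts a message of size $RL$ bits, depending on the files, $I$ and the demands, such that each active user $i$ recovers $W_{d_i}$ from the message and its own cache. $R$ is the rate. The scheme must work for all files, all $I$ and all demands. PDA. For positive integers $K,F,Z,S$, a $[K,F,Z,S]$-PDA is an $F\times K$ array $(p_{j,k})$ with entries in $\{*\}\cup[S]$ such that: (C1) $*$ appears $Z$ times in each column; (C2) each integer of $[S]$ occurs at least once; (C3) if two distinct entries satisfy $p_{j_1,k_1}=p_{j_2,k_2}=s\in[S]$,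 then $j_1\ne j_2$, $k_1\neq k_2$ and $p_{j_1,k_2}=p_{j_2,k_1}=*$. HpPDA. Let $K,K',F,F',Z,Z',S$ be integers with $K\ge K'$, $F\ge F'$, $Z<F'$. A $(K,K',F,F',Z,Z',S)$-HpPDA is a pair $(P,B)$ where $P=(p_{f,k})_{f\in[F],k\in[K]}$ is an array with entries ''$*$'' or ''null'', each column having exactly $Z$ stars; $B=(b_{f,k})_{f\in[F'],k\in[K']}$ is a $[K',F',Z',S]$-PDA; and for each $\tau\subseteq[K]$ with $|\tau|=K'$ there is $\zeta\subseteq[F]$ with $|\zeta|=F'$ such that the subarray $[P]_{\zeta\times\tau}$ of $P$ (rows $\zeta$, columns $\tau$, listed in a suitable order) has its stars in exactly the same positions as $B$. HpPDA-based algorithm. Placement: divide each $W_n$ into $F'$ equal subfiles and encode them with an $[F,F']$ MDS code (any $F'$ of the $F$ coded symbols determine the information) into coded subfiles $C_{n,1},\dots,C_{n,F}$; user $k$ stores $\{C_{n,f}: p_{f,k}=*,\ n\in[N], f\in[F]\}$. Delivery: given the active set $I$ with demands $(d_k)_{k\in I}$, take $\zeta$ corresponding to $\tau=I$, and fill the null entries of $[P]_{\zeta\times I}$ with integers to obtain an array $\overline P=(\overline p_{f,k})_{f\in\zeta,k\in I}$ equal to $B$; for each $s\in[S]$ the server sends $X_s=\sum_{f\in\zeta,\,k\in I,\ \overline p_{f,k}=s} C_{d_k,f}$. *)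

(* Defs.v *)
From HB Require Import structures.
From mathcomp Require Import all_boot all_order all_algebra.

Set Implicit Arguments.
Unset Strict Implicit.
Unset Printing Implicit Defensive.

Import GRing.Theory Num.Theory.

Local Open Scope ring_scope.

(* The entry [None] is the star, [Some s] is the integer s; the set of
   integers is 'I_S = {0, ..., S-1} instead of {1, ..., S}. *)
Definition is_PDA (K F Z S : nat) (B : 'M[option 'I_S]_(F, K)) : Prop :=
  [/\ [/\ (0 < K)%N, (0 < F)%N, (0 < Z)%N & (0 < S)%N],
      forall k, #|[set j | B j k == None]| = Z,
      forall s, exists j k, B j k = Some s
    & forall j1 k1 j2 k2 s,
        (j1, k1) <> (j2, k2) -> B j1 k1 = Some s -> B j2 k2 = Some s ->
        [/\ j1 <> j2, k1 <> k2, B j1 k2 = None & B j2 k1 = None]].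

(* The arrays P have entries "star" ([true]) or "null" ([false]).
   [rpos] and [cpos] list the rows zeta and the columns tau in some order:
   f \in zeta is row number [rpos f] of the subarray, and k \in tau is its
   column number [cpos k].  Their values outside zeta and tau are irrelevant. *)
Definition same_stars (K K' F F' S : nat) (P : 'M[bool]_(F, K))
    (B : 'M[option 'I_S]_(F', K')) (tau : {set 'I_K}) (zeta : {set 'I_F})
    (rpos : 'I_F -> 'I_F') (cpos : 'I_K -> 'I_K') : Prop :=
  [/\ #|tau| = K', #|zeta| = F',
      {in zeta &, injective rpos}, {in tau &, injective cpos}
    & {in zeta & tau, forall f k, P f k = (B (rpos f) (cpos k) == None)}].

Definition is_HpPDA (K K' F F' Z Z' S : nat) (P : 'M[bool]_(F, K))
    (B : 'M[option 'I_S]_(F', K')) : Prop :=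
  [/\ [/\ (K' <= K)%N, (F' <= F)%N & (Z < F')%N],
      forall k, #|[set f | P f k]| = Z,
      is_PDA Z' B
    & forall tau : {set 'I_K}, #|tau| = K' ->
        exists zeta rpos cpos, same_stars P B tau zeta rpos cpos].

Definition library (N L : nat) := {ffun 'I_N -> L.-tuple bool}.

Definition demands (K N : nat) (I : {set 'I_K}) :=
  {ffun {i : 'I_K | i \in I} -> 'I_N}.

(* Files of L bits, caches of c bits, broadcast messages of r bits.  A decoder
   knows the user's identity, the active set and the demands, all of which are
   public during delivery. *)
Record hotplug_scheme (K K' N L c r : nat) := HotplugScheme {
  cache : 'I_K -> library N L -> c.-tuple bool;
  broadcast : forall I : {set 'I_K},
    demands N I -> library N L -> r.-tuple bool;
  decode : forall I : {set 'I_K}, demands N I -> {i : 'I_K | i \in I} ->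
    r.-tuple bool -> c.-tuple bool -> L.-tuple bool;
  decodeP : forall (W : library N L) (I : {set 'I_K}) (d : demands N I)
      (i : {i : 'I_K | i \in I}), #|I| = K' ->
    decode d i (broadcast d W) (cache (val i) W) = W (d i)
}.

Definition memory (K K' N L c r : nat) (_ : hotplug_scheme K K' N L c r) : rat :=
  c%:R / L%:R.

Definition rate (K K' N L c r : nat) (_ : hotplug_scheme K K' N L c r) : rat :=
  r%:R / L%:R.

(* [G] is the generator matrix of a linear [F, F'] code. *)
Definition is_MDS (Fq : finFieldType) (F F' : nat) (G : 'M[Fq]_(F', F)) : Prop :=
  forall zeta : {set 'I_F}, #|zeta| = F' ->
  forall u v : 'rV[Fq]_F',
    {in zeta, forall f, (u *m G) 0 f = (v *m G) 0 f} -> u = v.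

(* The choices left open by the algorithm: a subfile size of b bits, an
   [F, F'] MDS code over a finite field, an identification of blocks of b bits
   with vectors of l field symbols (which forces the field to have
   characteristic 2), and for each active set I a row set zeta with orders of
   zeta and I for which the subarray matches B. *)
Record hppda_setup (K K' F F' S : nat) (P : 'M[bool]_(F, K))
    (B : 'M[option 'I_S]_(F', K')) := HppdaSetup {
  sub_bits : nat;
  sub_bits_gt0 : (0 < sub_bits)%N;
  code_field : finFieldType;
  sub_len : nat;
  sym_of_bits : sub_bits.-tuple bool -> 'rV[code_field]_sub_len;
  bits_of_sym : 'rV[code_field]_sub_len -> sub_bits.-tuple bool;
  sym_of_bitsK : cancel sym_of_bits bits_of_sym;
  bits_of_symK : cancel bits_of_sym sym_of_bits;
  code_gen : 'M[code_field]_(F', F);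
  code_MDS : is_MDS code_gen;
  row_set : {set 'I_K} -> {set 'I_F};
  row_pos : {set 'I_K} -> 'I_F -> 'I_F';
  col_pos : {set 'I_K} -> 'I_K -> 'I_K';
  setupP : forall I : {set 'I_K}, #|I| = K' ->
    same_stars P B I (row_set I) (row_pos I) (col_pos I)
}.

Arguments sym_of_bits {K K' F F' S P B h} _.
Arguments bits_of_sym {K K' F F' S P B h} _.

Section Algorithm.

Variables (K K' F F' S : nat) (P : 'M[bool]_(F, K)).
Variables (B : 'M[option 'I_S]_(F', K')) (E : hppda_setup P B).
Variable (N : nat).

Let b := sub_bits E.

(* [mxvec_index] numbers row-major, so this is the j-th of F' consecutive
   blocks of b bits. *)
Definition subfile (w : (F' * b).-tuple bool) (j : 'I_F') : b.-tuple bool :=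
  [tuple tnth w (mxvec_index j t) | t < b].

Definition coded_subfile (w : (F' * b).-tuple bool) (f : 'I_F) :
    'rV[code_field E]_(sub_len E) :=
  \sum_(j < F') code_gen E j f *: sym_of_bits (subfile w j).

Definition hppda_cache (k : 'I_K) (W : library N (F' * b)) : seq bool :=
  flatten [seq tval (bits_of_sym (coded_subfile (W n) f))
          | n <- enum 'I_N, f <- enum [set f | P f k]].

Definition filled_array (I : {set 'I_K}) (f : 'I_F) (k : 'I_K) : option 'I_S :=
  B (row_pos E I f) (col_pos E I k).

Definition hppda_signal (I : {set 'I_K}) (d : demands N I)
    (W : library N (F' * b)) (s : 'I_S) : 'rV[code_field E]_(sub_len E) :=
  \sum_(f in row_set E I)
    \sum_(k : {i : 'I_K | i \in I} | filled_array I f (val k) == Some s)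
      coded_subfile (W (d k)) f.

Definition hppda_broadcast (I : {set 'I_K}) (d : demands N I)
    (W : library N (F' * b)) : seq bool :=
  flatten [seq tval (bits_of_sym (hppda_signal d W s)) | s <- enum 'I_S].

Definition obtained_by_hppda (c r : nat)
    (A : hotplug_scheme K K' N (F' * b) c r) : Prop :=
  (forall k W, tval (cache A k W) = hppda_cache k W) /\
  (forall (I : {set 'I_K}) (d : demands N I) W, #|I| = K' ->
     tval (broadcast A d W) = hppda_broadcast d W).

End Algorithm.

(* Main.v *)
Require Import Defs.
From HB Require Import structures.
From mathcomp Require Import all_boot all_order all_algebra.
From mathcomp Require Import finfield.
Set Implicit Arguments.
Unset Strict Implicit.
Unset Printing Implicit Defensive.
Import GRing.Theory Num.Theory.
Local Open Scope ring_scope.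

(** Decoding only needs that the broadcast together with the cache of user i
determines the file requested by i. In the signal containing a missing coded
subfile of i, condition (C3) puts a star in column i on the row of every other
summand, so i can cancel these summands; thus i knows all coded subfiles of its
file on the F' rows of zeta, and the MDS property recovers the file. A suitable
MDS code is the Reed-Solomon code over a field with 2^m > F elements. *)

Lemma size_flatten_tuples (T A : Type) (b : nat) (g : T -> b.-tuple A)
    (s : seq T) :
  size (flatten [seq tval (g x) | x <- s]) = (size s * b)%N.
Proof. by elim: s => //= x s IHs; rewrite size_cat IHs size_tuple mulSn. Qed.

(** All blocks have the same length [b], so a concatenation can be cut back into its blocks. This
    reads single symbols off a cache or a broadcast. *)
Lemma flatten_tuples_inj (T A : eqType) (b : nat)
    (g h : T -> b.-tuple A) (s : seq T) :
  flatten [seq tval (g x) | x <- s] = flatten [seq tval (h x) | x <- s] ->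
  {in s, g =1 h}.
Proof.
elim: s => //= y s IHs /eqP.
rewrite eqseq_cat ?size_tuple // => /andP[/eqP/val_inj ghy /eqP/IHs ghs] x.
by rewrite inE => /predU1P[-> | /ghs].
Qed.

Lemma allpairs_tuplesE (T U A : Type) (b : nat) (g : T -> U -> b.-tuple A)
    (s : seq T) (t : seq U) :
  [seq tval (g x y) | x <- s, y <- t] =
  [seq tval (g p.1 p.2) | p <- [seq (x, y) | x <- s, y <- t]].
Proof. by rewrite map_allpairs. Qed.

(** If two messages agree on [zeta], their difference is a polynomial of size at most [F'] with [F']
    distinct roots, hence zero. *)
Lemma reed_solomon_MDS (Fq : finFieldType) (F F' : nat) (a : 'I_F -> Fq) :
  injective a -> is_MDS (\matrix_(j < F', f < F) a f ^+ j).
Proof.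
move=> a_inj zeta card_zeta u v eq_uv; apply: subr0_eq.
have evalE (w : 'rV[Fq]_F') f :
    (rVpoly w).[a f] = (w *m \matrix_(j < F', f < F) a f ^+ j) 0 f.
  rewrite (@horner_coef_wide _ F') ?size_poly // mxE.
  by apply: eq_bigr => j _; rewrite coef_rVpoly_ord mxE.
apply: (can_inj rVpolyK); rewrite linear0.
have [//|nz] := eqVneq (rVpoly (u - v)) 0.
have roots : all (root (rVpoly (u - v))) [seq a f | f <- enum zeta].
  apply/allP => x /mapP[f]; rewrite mem_enum => fz ->.
  by rewrite /root evalE mulmxBl mxE [X in _ + X]mxE eq_uv // subrr.
have := max_poly_roots nz roots.
rewrite map_inj_uniq // enum_uniq size_map -cardE card_zeta => /(_ isT).
by rewrite ltnNge size_poly.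
Qed.

Lemma card_eq_bij (T U : finType) :
  #|T| = #|U| -> exists f : T -> U, bijective f.
Proof.
move=> eq_card; exists (fun x => enum_val (cast_ord eq_card (enum_rank x))).
by exists (fun y => enum_val (cast_ord (esym eq_card) (enum_rank y))) => x;
  rewrite enum_valK ?cast_ordK ?cast_ordKV enum_rankK.
Qed.

(** There are finitely many sets [I], so the choice is constructive. *)
Lemma same_stars_choice (K K' F F' Z Z' S : nat) (P : 'M[bool]_(F, K))
    (B : 'M[option 'I_S]_(F', K')) :
  is_HpPDA Z Z' P B ->
  exists zr : {set 'I_K} ->
      {set 'I_F} * (('I_F -> 'I_F') * ('I_K -> 'I_K')),
    forall I : {set 'I_K}, #|I| = K' ->
      same_stars P B I (zr I).1 (zr I).2.1 (zr I).2.2.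
Proof.
case=> _ _ [[K'_gt0 F'_gt0 _ _] _ _ _] stars.
apply: (fin_all_exists (P := fun (I : {set 'I_K}) zr =>
  #|I| = K' -> same_stars P B I zr.1 zr.2.1 zr.2.2)) => I.
have [/stars[zeta [rp [cp ss]]] | card_neq] := #|I| =P K'.
  by exists (zeta, (rp, cp)).
(* A dummy value for sets of the wrong size; positivity of the dimensions of [B] supplies the
   constant functions. *)
by exists (set0, ((fun=> Ordinal F'_gt0), (fun=> Ordinal K'_gt0))).
Qed.

Lemma hppda_setup_exists (K K' F F' Z Z' S : nat) (P : 'M[bool]_(F, K))
    (B : 'M[option 'I_S]_(F', K')) :
  is_HpPDA Z Z' P B -> inhabited (hppda_setup P B).
Proof.
move=> HPB; have [zr zrP] := same_stars_choice HPB.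
(* With [2 ^ F.+1] elements the field has at least [F] evaluation points, and one symbol corresponds
   to a block of [F.+1] bits. *)
have [Fq _ cardFq] := pPrimePowerField (isT : prime 2) (ltn0Sn F).
have [|phi [psi phiK psiK]] :=
    @card_eq_bij (F.+1.-tuple bool) 'rV[Fq]_1.
  by rewrite card_tuple card_bool card_mx cardFq muln1 expn1.
have leF : (F <= #|Fq|)%N.
  by rewrite cardFq; apply: ltnW; apply: ltn_trans (ltn_expl _ _).
have a_inj : injective (fun f : 'I_F => enum_val (widen_ord leF f) : Fq).
  by move=> f g /enum_val_inj/(congr1 val)/= /val_inj.
exact: (inhabits (HppdaSetup (ltn0Sn F) phiK psiK
  (reed_solomon_MDS (F' := F') a_inj) zrP)).
Qed.

Section Decodability.

Variables (K K' F F' S : nat) (P : 'M[bool]_(F, K)).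
Variables (B : 'M[option 'I_S]_(F', K')) (E : hppda_setup P B).

Local Notation b := (sub_bits E).

Lemma subfile_inj (w w' : (F' * b).-tuple bool) :
  (forall j, subfile w j = subfile w' j) -> w = w'.
Proof.
move=> eqw; apply: eq_from_tnth => x; case/mxvec_indexP: x => j t.
by have := congr1 (fun u => tnth u t) (eqw j); rewrite !tnth_mktuple.
Qed.

(** The code acts coordinatewise on vectors of symbols: for fixed [t], the [t]-th coordinates of the
    subfiles form a message whose codeword consists of the [t]-th coordinates of the coded subfiles.
    The MDS property then applies to each [t] separately. *)
Lemma coded_subfile_inj (zeta : {set 'I_F}) (w w' : (F' * b).-tuple bool) :
  #|zeta| = F' ->
  {in zeta, forall f, coded_subfile w f = coded_subfile w' f} -> w = w'.
Proof.
move=> card_zeta eqw; apply: subfile_inj => j.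
apply: (can_inj (sym_of_bitsK (h := E))).
apply/rowP => t.
pose layer (v : (F' * b).-tuple bool) : 'rV_F' :=
  \row_i (sym_of_bits (subfile v i) : 'rV[code_field E]_(sub_len E)) 0 t.
have layerE v f : (layer v *m code_gen E) 0 f = (coded_subfile v f) 0 t.
  rewrite mxE summxE; apply: eq_bigr => i _.
  by rewrite !mxE mulrC.
have eq_layer : layer w = layer w'.
  by apply: (code_MDS card_zeta) => f fz; rewrite !layerE eqw.
by have := congr1 (fun u : 'rV_F' => u 0 j) eq_layer; rewrite !mxE.
Qed.

Variable N : nat.

Lemma size_hppda_cache (Z : nat) (k : 'I_K) (W : library N (F' * b)) :
  #|[set f | P f k]| = Z -> size (hppda_cache k W) = (N * Z * b)%N.
Proof.
move=> cardZ; rewrite /hppda_cache allpairs_tuplesE size_flatten_tuples.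
by rewrite size_allpairs -!cardE card_ord cardZ.
Qed.

Lemma size_hppda_broadcast (I : {set 'I_K}) (d : demands N I)
    (W : library N (F' * b)) : size (hppda_broadcast d W) = (S * b)%N.
Proof. by rewrite size_flatten_tuples -cardE card_ord. Qed.

Lemma hppda_cache_inj (k : 'I_K) (W W' : library N (F' * b)) :
  hppda_cache k W = hppda_cache k W' ->
  forall n f, P f k -> coded_subfile (W n) f = coded_subfile (W' n) f.
Proof.
rewrite /hppda_cache !allpairs_tuplesE => /flatten_tuples_inj eqc n f Pfk.
apply: (can_inj (bits_of_symK (h := E))); apply: (eqc (n, f)).
by apply/allpairsP; exists (n, f); split; rewrite ?mem_enum ?inE.
Qed.

Lemma hppda_broadcast_inj (I : {set 'I_K}) (d : demands N I)
    (W W' : library N (F' * b)) :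
  hppda_broadcast d W = hppda_broadcast d W' ->
  forall s, hppda_signal d W s = hppda_signal d W' s.
Proof.
move=> /flatten_tuples_inj eqb s; apply: (can_inj (bits_of_symK (h := E))).
by apply: eqb; rewrite mem_enum.
Qed.

(** Comparing two libraries turns the cancellation of known summands into the vanishing of their
    differences. *)
Lemma hppda_decodable (Z' : nat) (I : {set 'I_K}) (d : demands N I)
    (i : {i : 'I_K | i \in I}) (W W' : library N (F' * b)) :
  is_PDA Z' B -> #|I| = K' ->
  hppda_broadcast d W = hppda_broadcast d W' ->
  hppda_cache (val i) W = hppda_cache (val i) W' -> W (d i) = W' (d i).
Proof.
move=> [_ _ _ C3] cardI /hppda_broadcast_inj eq_signal /hppda_cache_inj eq_star.
have [_ card_zeta rinj cinj starE] := setupP E cardI.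
apply: (coded_subfile_inj card_zeta) => f fz.
have [Pfi | notP] := boolP (P f (val i)); first exact: eq_star.
move: (starE _ _ fz (valP i)); rewrite (negbTE notP).
case Bs: (B _ _) => [s|//] _.
apply/eqP; rewrite -subr_eq0; apply/eqP.
(* The difference of the two signals for [s] is zero; the summand at [(f, i)] is isolated in it,
   first by row, then by user. *)
have := eq_signal s; move/eqP; rewrite -subr_eq0 -sumrB.
rewrite (bigD1 f) //= -sumrB (bigD1 i) /=; last by rewrite /filled_array Bs.
have cancel f' (k : {i : 'I_K | i \in I}) : f' \in row_set E I ->
    filled_array E I f' (val k) == Some s -> (f', k) != (f, i) ->
    coded_subfile (W (d k)) f' - coded_subfile (W' (d k)) f' = 0.
  move=> f'z /eqP Bs' ne; rewrite eq_star ?subrr // starE ?(valP i) //.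
  (* (C3) speaks of cells of [B]; injectivity of the row and column orders keeps the two cells
     distinct. *)
  have neq : (row_pos E I f, col_pos E I (val i)) <>
      (row_pos E I f', col_pos E I (val k)).
    case=> /(rinj _ _ fz f'z) eqf /(cinj _ _ (valP i) (valP k))/val_inj eqi.
    by rewrite eqf eqi eqxx in ne.
  by have [_ _ _ ->] := C3 _ _ _ _ _ neq Bs Bs'.
(* First the other users in row [f] drop out, then all other rows. *)
rewrite [X in _ + X + _]big1 ?addr0; last first.
  by move=> k /andP[Bs' ne]; apply: cancel; rewrite // xpair_eqE eqxx.
rewrite big1 ?addr0; first by move/eqP.
move=> f' /andP[f'z ne]; rewrite -sumrB big1 // => k Bs'.
by apply: cancel; rewrite // xpair_eqE (negbTE ne).
Qed.

End Decodability.

(** Exhaustive search decodes: any candidate matching the observations has the right value, and [t]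
    itself matches, so the default [u0] is never returned here. *)
Lemma determined_decoder (T : finType) (U : Type) (X Y : eqType)
    (x : T -> X) (y : T -> Y) (u : T -> U) (u0 : U) :
  (forall t t', x t = x t' -> y t = y t' -> u t = u t') ->
  forall t, oapp u u0 [pick t' | (x t' == x t) && (y t' == y t)] = u t.
Proof.
move=> det t; case: pickP => [t' /andP[/eqP ? /eqP ?] | /(_ t)] /=.
  exact: det.
by rewrite !eqxx.
Qed.

Lemma hppda_scheme_exists (K K' F F' Z Z' S N : nat) (P : 'M[bool]_(F, K))
    (B : 'M[option 'I_S]_(F', K')) (E : hppda_setup P B) :
  is_HpPDA Z Z' P B ->
  exists A : hotplug_scheme K K' N (F' * sub_bits E)
      (N * Z * sub_bits E) (S * sub_bits E),
    obtained_by_hppda A.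
Proof.
case=> _ colZ PDA_B _; set b := sub_bits E.
pose ca k (W : library N (F' * b)) : (N * Z * b).-tuple bool :=
  Tuple (introT eqP (size_hppda_cache W (colZ k))).
pose br I (d : demands N I) (W : library N (F' * b)) : (S * b).-tuple bool :=
  Tuple (introT eqP (size_hppda_broadcast d W)).
pose de I (d : demands N I) (i : {i : 'I_K | i \in I}) m c :=
  oapp (fun W : library N (F' * b) => W (d i)) [tuple of nseq (F' * b) false]
    [pick W | (br I d W == m) && (ca (val i) W == c)].
have deP W I (d : demands N I) (i : {i : 'I_K | i \in I}) : #|I| = K' ->
    de I d i (br I d W) (ca (val i) W) = W (d i).
  move=> cardI.
  apply: (determined_decoder (u := fun W : library N (F' * b) => W (d i))).
  move=> V V' /(congr1 val) eqb /(congr1 val) eqc.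
  exact: hppda_decodable PDA_B cardI eqb eqc.
by exists (HotplugScheme deP).
Qed.

Theorem theorem3 (K K' F F' Z Z' S N : nat) (P : 'M[bool]_(F, K))
    (B : 'M[option 'I_S]_(F', K')) (HPB : is_HpPDA Z Z' P B)
    (HN : (1 <= N)%N) :
  (exists (E : hppda_setup P B) (c r : nat)
      (A : hotplug_scheme K K' N (F' * sub_bits E) c r),
    [/\ obtained_by_hppda A,
        memory A / N%:R = Z%:R / F'%:R,
        memory A < N%:R
      & rate A = S%:R / F'%:R])
  /\
  (forall E : hppda_setup P B,
    exists (c r : nat) (A : hotplug_scheme K K' N (F' * sub_bits E) c r),
    [/\ obtained_by_hppda A,
        memory A / N%:R = Z%:R / F'%:R,
        memory A < N%:R
      & rate A = S%:R / F'%:R]).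
Proof.
(* Both conjuncts reduce to an arbitrary setup; the first also uses that a setup exists. *)
suff main (E : hppda_setup P B) :
    exists (c r : nat) (A : hotplug_scheme K K' N (F' * sub_bits E) c r),
    [/\ obtained_by_hppda A,
        memory A / N%:R = Z%:R / F'%:R,
        memory A < N%:R
      & rate A = S%:R / F'%:R].
  by split=> //; have [E] := hppda_setup_exists HPB; exists E; apply: main.
have [A obtA] := hppda_scheme_exists N E HPB.
exists (N * Z * sub_bits E)%N, (S * sub_bits E)%N, A.
have [[_ _ ltZ] _ [[_ F'_gt0 _ _] _ _ _] _] := HPB.
have b_neq0 : (sub_bits E)%:R != 0 :> rat.
  by rewrite pnatr_eq0 -lt0n sub_bits_gt0.
have N_neq0 : N%:R != 0 :> rat by rewrite pnatr_eq0 -lt0n.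
have memE : memory A = N%:R * (Z%:R / F'%:R).
  by rewrite /memory !natrM -mulf_div divff // mulr1 mulrA.
split=> //.
- by rewrite memE mulrC mulKf.
(* After division by [N] this is [Z < F'], part of the definition of an HpPDA. *)
- rewrite memE gtr_pMr ?ltr0n // ltr_pdivrMr ?ltr0n //.
  by rewrite mul1r ltr_nat.
- by rewrite /rate !natrM -mulf_div divff // mulr1.
Qed.
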